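(* Let $N$ be an LG number, with $N>10^{(10^{13})}$, and let $p_r$ be the largest prime factor of $N$. Then $p_r<\log N$.
   Context: $\log$ is the natural logarithm, $\gamma$ is the Euler–Mascheroni constant, $\sigma(n)=\sum_{d\mid n}d$, $\rho(n)=\sigma(n)/n$, and $G(n)=\rho(n)/\log\log n$. A counterexample to the Robin hypothesis is an integer $n>5040$ with $G(n)\ge e^{\gamma}$. An LG (largest $G$-value) number is a counterexample $N>5040$ at which $G$ attains its largest value among counterexamples; equivalently, $N>5040$, $G(N)\ge e^\gamma$, and $G(m)\le G(N)$ for all integers $m>5040$. (Existence of LG numbers is not asserted.) *)

(* Defs.v *)
From HB Require Import structures.
From mathcomp Require Import all_boot all_order all_algebra.
From mathcomp Require Import all_classical all_reals all_analysis.

Set Implicit Arguments.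
Unset Strict Implicit.
Unset Printing Implicit Defensive.

Import Order.TTheory GRing.Theory Num.Theory.
Import numFieldNormedType.Exports.

Local Open Scope classical_set_scope.
Local Open Scope ring_scope.

(* H_n - ln n; [lim] is total, but this sequence does converge. *)
Definition euler_gamma (R : realType) : R :=
  lim ((fun n : nat => \sum_(1 <= k < n.+1) k%:R^-1 - ln n%:R : R) @ \oo).

Definition sigma (n : nat) : nat := (\sum_(d <- divisors n) d)%N.

Definition rho (R : realType) (n : nat) : R := (sigma n)%:R / n%:R.

Definition G (R : realType) (n : nat) : R := rho R n / ln (ln n%:R).

Definition robin_counterexample (R : realType) (n : nat) : Prop :=
  (5040 < n)%N /\ expR (euler_gamma R) <= G R n.

Definition LG (R : realType) (N : nat) : Prop :=
  robin_counterexample R N /\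
  forall m : nat, robin_counterexample R m -> G R m <= G R N.

(* Main.v *)
Require Import Defs.
From mathcomp Require Import all_boot all_order all_algebra.
From mathcomp Require Import all_classical all_reals all_analysis.
From mathcomp Require Import ring lra.
Import Order.TTheory GRing.Theory Num.Theory.
Import numFieldNormedType.Exports.

(** Let p be the largest prime factor of N, and m = N / p.  The proof compares
    G(N) with G(m).  Removing the prime p costs little in rho, namely
    rho(N) <= (1 + 1/p) rho(m) ([rho_mul_prime_le]), whatever the exponent of p
    in N.  Since m is no better than N, i.e. G(m) <= G(N), this forces
      ln ln N <= (1 + 1/p) ln ln m.
    With L = ln N we have ln m = L - ln p, so that ln ln N - ln ln m is at least
    ln p / L by concavity of the logarithm; hence
      ln p / L <= (ln ln m) / p < (ln L) / p,
    that is p ln p < L ln L, and p < L because x ln x is increasing for x >= 1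
    ([lt_of_lnln_le]).

    The comparison G(m) <= G(N) comes from the maximality of G(N), which speaks
    only of integers above 5040, so the case m <= 5040 is excluded separately.
    There rho(N) <= 2 rho(m) <= 2 (1 + ln m) <= 2 + 8 ln 10 ([rho_le_ln]), while
    ln ln N >= 13 ln 10 ([lnln_ge]); so G(N) < 1, which contradicts
    G(N) >= exp(gamma) >= 1 ([euler_gamma_ge0]). *)

Local Open Scope ring_scope.

(** Every estimate of a difference of logarithms below is an instance of this
    consequence of ln (1 + x) <= x; exchanging a and b gives the upper bound. *)
Lemma ln_sub_ge (R : realType) (a b : R) (ha : 0 < a) (hb : 0 < b) :
  1 - a / b <= ln b - ln a.
Proof.
have hab : 0 < a / b by rewrite divr_gt0.
have := @le_ln1Dx R (a / b - 1).
have -> : 1 + (a / b - 1) = a / b by ring.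
rewrite ln_div ?posrE // => h.
by have := h ltac:(lra); lra.
Qed.

(** A crude substitute for e <= 4 that needs no numerical value of e. *)
Lemma one_le_ln4 (R : realType) : 1 <= ln 4 :> R.
Proof.
have -> : 4 = 2 ^+ 2 :> R by rewrite -natrX.
have := @ln_sub_ge R 1 2 ltr01 (ltr0n R 2).
by rewrite ln1 lnXn //; lra.
Qed.

(** Monotonicity of H_n - ln n for n >= 1.  It fails from n = 0 to n = 1, as
    ln 0 = 0 by convention, hence the shifted index. *)
Lemma harmonic_sub_ln_decr (R : realType) (n : nat) :
  \sum_(1 <= k < n.+3) k%:R^-1 - ln n.+2%:R
    <= \sum_(1 <= k < n.+2) k%:R^-1 - ln n.+1%:R :> R.
Proof.
have h1 : 0 < n.+1%:R :> R by rewrite ltr0n.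
have h2 : 0 < n.+2%:R :> R by rewrite ltr0n.
rewrite (@big_nat_recr _ _ _ n.+2) //=.
have := ln_sub_ge _ _ _ h1 h2.
have -> : 1 - n.+1%:R / n.+2%:R = n.+2%:R^-1 :> R.
  by rewrite -[n.+2]addn1 natrD; move: (n.+1%:R) h1 => x h1; field; lra.
move: (\sum_(1 <= k < n.+2) _) (n.+2%:R^-1) (ln n.+2%:R) (ln n.+1%:R) => S x y z; lra.
Qed.

Lemma ln_le_harmonic (R : realType) (n : nat) :
  ln n.+1%:R <= \sum_(1 <= k < n.+1) k%:R^-1 :> R.
Proof.
elim: n => [|n ih]; first by rewrite big_nil ln1.
have h1 : 0 < n.+1%:R :> R by rewrite ltr0n.
have h2 : 0 < n.+2%:R :> R by rewrite ltr0n.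
rewrite big_nat_recr //=.
have := ln_sub_ge _ _ _ h2 h1.
have -> : 1 - n.+2%:R / n.+1%:R = - n.+1%:R^-1 :> R.
  by rewrite -[n.+2]addn1 natrD; move: (n.+1%:R) h1 => x h1; field; lra.
move: (\sum_(1 <= k < n.+1) _) (n.+1%:R^-1) (ln n.+2%:R) (ln n.+1%:R) ih => S x y z; lra.
Qed.

Lemma harmonic_le_ln (R : realType) (n : nat) (hn : (0 < n)%N) :
  \sum_(1 <= k < n.+1) k%:R^-1 <= 1 + ln n%:R :> R.
Proof.
case: n hn => // n _.
elim: n => [|n ih]; first by rewrite big_nat1 invr1 ln1 addr0.
by have := @harmonic_sub_ln_decr R n; lra.
Qed.

(** [lim] carries information only for a convergent sequence, so convergence has
    to be proved first: from n = 1 on the sequence H_n - ln n decreases and is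
    bounded below by 0. *)
Lemma euler_gamma_ge0 (R : realType) : 0 <= euler_gamma R.
Proof.
rewrite /euler_gamma; set u := (fun n : nat => _).
have u_ge0 n : 0 <= u n.+1.
  rewrite /u subr_ge0; apply: le_trans (@ln_le_harmonic R n.+1).
  by rewrite ler_ln ?posrE ?ltr0n // ler_nat.
have v_cvg : cvgn (fun n => u n.+1).
  apply: nonincreasing_is_cvgn.
    by apply/nonincreasing_seqP => n; apply: harmonic_sub_ln_decr.
  by exists 0 => _ [n _ <-].
apply: limr_ge; last by exists 1%N => // -[].
by move/cvg_ex: v_cvg => [l ul]; apply/cvg_ex; exists l; rewrite -cvg_shiftS.
Qed.

(** A divisor of p m is either a divisor of m or p times a divisor of m.  There is
    equality when p does not divide m; otherwise some divisors are counted
    twice, which only helps. *)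
Lemma sigma_mul_prime_le (p m : nat) (hp : prime p) (hm : (0 < m)%N) :
  (sigma (p * m) <= p.+1 * sigma m)%N.
Proof.
have hp0 := prime_gt0 hp; have hpm : (0 < p * m)%N by rewrite muln_gt0 hp0.
have -> : (p.+1 * sigma m
           = \sum_(d <- divisors m ++ [seq p * d | d <- divisors m]) d)%N.
  by rewrite big_cat big_map -big_distrr /= mulSn.
rewrite /sigma; apply: (@sub_le_big_seq _ addn leq leqnn (fun x y => leq_addr y x)) => d.
rewrite count_uniq_mem ?divisors_uniq //.
have [dpm|//] := boolP (d \in divisors (p * m)).
rewrite -has_count has_pred1 mem_cat; apply/orP.
move: dpm; rewrite -!dvdn_divisors // => dpm.
have [/dvdnP[e de]|npd] := boolP (p %| d)%N.
  right; apply/mapP; exists e; last by rewrite de mulnC.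
  by rewrite -dvdn_divisors // -(dvdn_pmul2l hp0) mulnC -de.
by left; rewrite -(@Gauss_dvdr _ p) // coprime_sym prime_coprime.
Qed.

Lemma rho_mul_prime_le (R : realType) (p m : nat) (hp : prime p) (hm : (0 < m)%N) :
  rho R (p * m) <= (1 + p%:R^-1) * rho R m.
Proof.
have hp0 : 0 < p%:R :> R by rewrite ltr0n prime_gt0.
have hm0 : 0 < m%:R :> R by rewrite ltr0n.
rewrite /rho natrM ler_pdivrMr ?mulr_gt0 //.
have -> : (1 + p%:R^-1) * ((sigma m)%:R / m%:R) * (p%:R * m%:R)
    = (p.+1 * sigma m)%:R :> R.
  by rewrite natrM -natr1; field; rewrite !gt_eqF.
by rewrite ler_nat sigma_mul_prime_le.
Qed.

(** Exchanging d with m / d turns rho(m) into the sum of 1/d over the divisors d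
    of m, which is a partial sum of the harmonic sum H_m. *)
Lemma rho_le_ln (R : realType) (m : nat) (hm : (0 < m)%N) :
  rho R m <= 1 + ln m%:R.
Proof.
apply: le_trans (@harmonic_le_ln R m hm).
have hm0 : m%:R != 0 :> R by rewrite pnatr_eq0 -lt0n.
have quotK d : (d %| m -> m %/ (m %/ d) = d)%N.
  by move=> dm; rewrite divnA // mulKn.
have -> : rho R m = \sum_(d <- divisors m) d%:R^-1.
  rewrite /rho /sigma natr_sum mulr_suml.
  rewrite -(@perm_big _ _ _ _ [seq m %/ d | d <- divisors m]%N) /=.
    rewrite big_map; apply: eq_big_seq => d; rewrite -dvdn_divisors // => dm.
    by rewrite natf_div // mulrAC divff ?mul1r.
  apply: uniq_perm; rewrite ?divisors_uniq //.
    rewrite map_inj_in_uniq ?divisors_uniq // => d e.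
    rewrite -!dvdn_divisors // => dm em eq_de.
    by rewrite -(quotK d dm) eq_de quotK.
  move=> d; apply/mapP/idP => [[e]|]; rewrite -!dvdn_divisors //.
    by move=> em ->; apply: dvdn_div.
  move=> dm; exists (m %/ d)%N; first by rewrite -dvdn_divisors // dvdn_div.
  by rewrite quotK.
rewrite (@perm_big _ _ _ _ _ [seq d <- index_iota 1 m.+1 | d %| m]%N).
  by rewrite big_filter big_mkcond; apply: ler_sum => d _; case: ifP.
apply: uniq_perm; rewrite ?divisors_uniq ?filter_uniq ?iota_uniq //.
move=> d; rewrite mem_filter mem_index_iota ltnS -dvdn_divisors //.
by have [dm|//] := boolP (d %| m)%N; rewrite /= (dvdn_gt0 hm dm) (dvdn_leq hm dm).
Qed.

Lemma rho_gt0 (R : realType) (m : nat) (hm : (0 < m)%N) : 0 < rho R m.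
Proof.
rewrite divr_gt0 ?ltr0n // /sigma.
by rewrite (big_rem m) ?divisors_id //= addn_gt0 hm.
Qed.

(** Here x stands for the prime p, L for ln N and L - ln x for ln (N / p). *)
Lemma lt_of_lnln_le (R : realType) (x L : R) (hx : 1 < x) (hL : 1 < L - ln x) :
  ln L <= (1 + x^-1) * ln (L - ln x) -> x < L.
Proof.
move=> hle.
have lnx : 0 < ln x by rewrite ln_gt0.
have L0 : 0 < L by lra.
have x0 : 0 < x by lra.
(* The relative gap (L - (L - ln x)) / L bounds the gap of the logarithms. *)
have low : ln x / L <= ln L - ln (L - ln x).
  have -> : ln x / L = 1 - (L - ln x) / L by field; lra.
  by apply: ln_sub_ge; lra.
have up : ln (L - ln x) < ln L by rewrite ltr_ln ?posrE; lra.
have key : ln x / L < ln L / x.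
  have : ln (L - ln x) / x < ln L / x by rewrite ltr_pM2r ?invr_gt0.
  lra.
rewrite ltNge; apply/negP => Lx.
have : ln L <= ln x by rewrite ler_ln ?posrE.
move: key; rewrite ltr_pdivrMr // mulrAC ltr_pdivlMr // => key lnLx.
have : ln L * L <= ln x * x by apply: ler_pM => //; [apply: ln_ge0; lra | lra].
lra.
Qed.

(** Keeping k symbolic prevents any evaluation of the tower 10 ^ (10 ^ k). *)
Lemma lnln_ge (R : realType) (k n : nat) (hn : (10 ^ (10 ^ k) < n)%N) :
  k%:R * ln 10 <= ln (ln n%:R) :> R.
Proof.
have ln10 : 1 <= ln 10 :> R.
  by apply: le_trans (one_le_ln4 R) _; rewrite ler_ln ?posrE // ler_nat.
have h : (10 ^+ k : R) <= ln n%:R.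
  apply: (@le_trans _ _ (10 ^+ k * ln 10)).
    by rewrite ler_peMr // exprn_ge0.
  rewrite -natrX mulr_natl -lnXn // ler_ln ?posrE ?exprn_gt0 ?ltr0n //;
    last by rewrite (leq_ltn_trans _ hn).
  by rewrite -natrX ler_nat ltnW.
by rewrite mulr_natl -lnXn // ler_ln ?posrE ?exprn_gt0 // (lt_le_trans _ h) ?exprn_gt0.
Qed.

Theorem theorem2 (R : realType) (N : nat) (hN : LG R N)
    (hlarge : (10 ^ (10 ^ 13) < N)%N) :
  (max_pdiv N)%:R < ln (N%:R : R).
Proof.
(* 10 ^ (10 ^ 13) leaves the context before anything can try to compute it. *)
have LLN := lnln_ge R _ _ hlarge; clear hlarge.
case: hN => -[N5040 GN] maxN.
have N0 : (0 < N)%N by apply: leq_ltn_trans N5040.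
have hp : prime (max_pdiv N) by apply: max_pdiv_prime; apply: leq_ltn_trans N5040.
move: (max_pdiv N) hp (max_pdiv_dvd N) => p hp /dvdnP[m]; rewrite mulnC => Npm.
have m0 : (0 < m)%N by move: N0; rewrite Npm muln_gt0 => /andP[].
have p1 : 1 < p%:R :> R by rewrite ltr1n prime_gt1.
have rN := @rho_mul_prime_le R p m hp m0; rewrite -Npm in rN.
have ln10 : 1 <= ln 10 :> R.
  by apply: le_trans (one_le_ln4 R) _; rewrite ler_ln ?posrE // ler_nat.
have rm := @rho_gt0 R m m0.
have LLN0 : 0 < ln (ln N%:R) :> R by lra.
have [m5040|m5040] := leqP m 5040.
  have : 1 <= G R N.
    by apply: le_trans GN; rewrite -expR0 ler_expR euler_gamma_ge0.
  rewrite /G ler_pdivlMr // mul1r => LLr.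
  have : p%:R^-1 * rho R m <= rho R m by rewrite ler_piMl ?invf_le1 //; lra.
  have := @rho_le_ln R m m0.
  have : ln m%:R <= 4 * ln 10 :> R.
    rewrite mulr_natl -lnXn // ler_ln ?posrE ?ltr0n ?exprn_gt0 //.
    by rewrite -natrX ler_nat (leq_trans m5040).
  lra.
have lnm : 1 < ln m%:R :> R.
  apply: le_lt_trans (one_le_ln4 R) _; rewrite ltr_ln ?posrE ?ltr0n // ltr_nat.
  by apply: leq_ltn_trans m5040.
have lnN : ln N%:R - ln p%:R = ln m%:R :> R.
  by rewrite Npm natrM lnM ?posrE ?ltr0n ?(prime_gt0 hp) // addrAC subrr add0r.
apply: lt_of_lnln_le; rewrite ?lnN //.
(* If m beat N, it would itself be a counterexample, against maximality. *)
have Gm : G R m <= G R N.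
  rewrite leNgt; apply/negP => lt_G.
  have : G R m <= G R N by apply: maxN; split=> //; apply: le_trans GN (ltW lt_G).
  by rewrite leNgt lt_G.
have LLm : 0 < ln (ln m%:R) :> R by rewrite ln_gt0.
move: Gm; rewrite /G ler_pdivrMr // mulrAC ler_pdivlMr // => Gm.
have : rho R N * ln (ln m%:R) <= (1 + p%:R^-1) * rho R m * ln (ln m%:R).
  by rewrite ler_pM2r.
by move=> /(le_trans Gm); rewrite [_ * rho R m * _]mulrAC [rho R m * _]mulrC ler_pM2r.
Qed.
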